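(* Let $\mathcal H$ be a real separable Hilbert space, let $T:\mathcal H\to\mathcal H$ be $\alpha$-averaged for some $\alpha\in(0,1]$ with $\operatorname{fix}T\ne\emptyset$, and let $R=\mathrm{id}-T$. Let $x,d\in\mathcal H$ and $\sigma\in[0,1)$ be fixed, and let $$\bar\tau=\begin{cases}1&\text{if }d=0,\\[2pt] \dfrac{1-\sigma}{4\alpha}\,\dfrac{\|Rx\|}{\|d\|}&\text{otherwise.}\end{cases}$$ Then, for all $\tau\in(0,\bar\tau]$, the point $w=x+\tau d$ satisfies $$\rho:=\|Rw\|^2-2\alpha\langle Rw,\,w-x\rangle\ \ge\ \sigma\,\|Rw\|\,\|Rx\| .$$
   Context: An operator $T$ is nonexpansive if $\|Tx-Ty\|\le\|x-y\|$ for all $x,y\in\mathcal H$; it is $\alpha$-averaged, $\alpha\in(0,1)$, if $T=(1-\alpha)\mathrm{id}+\alpha S$ for some nonexpansive $S:\mathcal H\to\mathcal H$; $1$-averaged means nonexpansive. $\operatorname{fix}T=\{z: Tz=z\}$. *)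

(* Defs.v *)
From HB Require Import structures.
From mathcomp Require Import all_boot all_order all_algebra.
From mathcomp Require Import all_classical all_reals.
From mathcomp Require Import topology normedtype.

Set Implicit Arguments.
Unset Strict Implicit.
Unset Printing Implicit Defensive.

Import Order.TTheory GRing.Theory Num.Theory numFieldNormedType.Exports.

Local Open Scope classical_set_scope.
Local Open Scope ring_scope.

Definition separable (T : topologicalType) : Prop :=
  exists2 D : set T, countable D & dense D.

(* A complete normed module over [R] is a real Hilbert space when its norm is
   induced by an inner product. Bilinearity, symmetry and positive definiteness
   are carried by the type [Dot.type idfun]: it is the Hermitian sesquilinear
   form with sign [false] (i.e. +1) and trivial conjugation [idfun]. *)
Definition norm_induced_by (R : realType) (H : completeNormedModType R)
    (dot : {dot H for idfun}) : Prop :=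
  forall u : H, `|u| = Num.sqrt (dot u u).

Definition nonexpansive (R : realType) (H : normedModType R) (T : H -> H) :
    Prop :=
  forall u v : H, `|T u - T v| <= `|u - v|.

(* False for [alpha] outside ]0, 1]. *)
Definition averaged (R : realType) (H : normedModType R) (alpha : R)
    (T : H -> H) : Prop :=
  (0 < alpha < 1 /\
   exists2 S : H -> H, nonexpansive S &
     forall u : H, T u = (1 - alpha) *: u + alpha *: S u) \/
  (alpha = 1 /\ nonexpansive T).

Definition fixpoints (H : Type) (T : H -> H) : set H := [set z | T z = z].

Definition residual (H : zmodType) (T : H -> H) (u : H) : H := u - T u.

Definition tau_bar (R : realType) (H : normedModType R) (T : H -> H)
    (alpha sigma : R) (x d : H) : R :=
  if d == 0 then 1
  else (1 - sigma) / (4 * alpha) * (`|residual T x| / `|d|).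

(* Main.v *)
Require Import Defs.
From HB Require Import structures.
From mathcomp Require Import all_boot all_order all_algebra.
From mathcomp Require Import all_classical all_reals.
From mathcomp Require Import topology normedtype.
From mathcomp Require Import lra.

Set Implicit Arguments.
Unset Strict Implicit.
Unset Printing Implicit Defensive.

Import Order.TTheory GRing.Theory Num.Theory numFieldNormedType.Exports.

Local Open Scope classical_set_scope.
Local Open Scope ring_scope.

(** With [T = (1 - alpha) id + alpha S], [S] nonexpansive, the residual map of
    [T] is [alpha (id - S)], hence [2 alpha]-Lipschitz
    ([residual_averaged_lipschitz]). Over a step of length [t = |w - x|] the
    residual norm therefore drops by at most [2 alpha t], and by Cauchy-Schwarz
    ([dot_le_norm]) the inner product in [rho] costs at most
    [2 alpha t |residual T w|]. Together,
    [rho >= |residual T w| (|residual T x| - 4 alpha t)],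
    and [tau_bar] ensures [4 alpha t <= (1 - sigma) |residual T x|]
    ([tau_bar_step_bound]); if [d = 0] then [t = 0] and this is trivial. *)

(** Cauchy-Schwarz is the triangle inequality squared: the latter is part of the
    structure of [H], and expanding [`|u + v| ^+ 2] isolates the cross term. *)
Lemma dot_le_norm (R : realType) (H : completeNormedModType R)
    (dot : {dot H for idfun}) (u v : H) :
  norm_induced_by dot -> dot u v <= `|u| * `|v|.
Proof.
move=> hdot.
have sq z : `|z| ^+ 2 = dot z z.
  rewrite hdot sqr_sqrtr //; have [->|z0] := eqVneq z 0; first by rewrite linear0r.
  by rewrite ltW // neq0_dnorm_gt0.
have dotC : dot v u = dot u v by rewrite hermC expr0 mul1r.
have : `|u + v| ^+ 2 <= (`|u| + `|v|) ^+ 2.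
  by rewrite ler_sqr ?nnegrE ?addr_ge0 // ler_normD.
rewrite sqrrD !sq linearDl !linearDr /= dotC.
lra.
Qed.

Lemma residual_averaged_lipschitz (R : realType) (H : normedModType R)
    (T : H -> H) (alpha : R) (u v : H) :
  averaged alpha T ->
  `|residual T u - residual T v| <= 2 * alpha * `|u - v|.
Proof.
have nonexp_bound (S : H -> H) : nonexpansive S ->
    `|residual S u - residual S v| <= 2 * `|u - v|.
  move=> hS; rewrite /residual.
  have -> : u - S u - (v - S v) = (u - v) - (S u - S v).
    by rewrite !opprB [S v - v]addrC addrACA [- S u + _]addrC.
  by apply: le_trans (ler_normB _ _) _; have := hS u v; lra.
case=> [[/andP[a0 _] [S hS TE]]|[-> hT]]; last by rewrite mulr1 nonexp_bound.
have resE z : residual T z = alpha *: residual S z.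
  by rewrite /residual TE scalerBl scale1r scalerBr opprD opprB addrA addrCA subrr addr0.
rewrite !resE -scalerBr normrZ gtr0_norm // [2 * alpha]mulrC -mulrA ler_pM2l //.
exact: nonexp_bound.
Qed.

Lemma tau_bar_step_bound (R : realType) (H : normedModType R) (T : H -> H)
    (alpha sigma : R) (x d : H) (tau : R) :
  0 < alpha -> sigma <= 1 -> 0 < tau <= tau_bar T alpha sigma x d ->
  4 * alpha * `|tau *: d| <= (1 - sigma) * `|residual T x|.
Proof.
move=> a0 s1; rewrite /tau_bar => /andP[t0].
case: eqP => [-> _|/eqP d0 le_tau].
  by rewrite scaler0 normr0 mulr0 mulr_ge0 ?subr_ge0.
have d_gt0 : 0 < `|d| by rewrite normr_gt0.
have a4 : 0 < 4 * alpha by rewrite mulr_gt0.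
rewrite normrZ gtr0_norm // mulrA -ler_pdivlMr // mulrC -ler_pdivlMr //.
by rewrite [leRHS]mulrAC [X in X * `|d|^-1]mulrAC -[leRHS]mulrA.
Qed.

Theorem theoremV4 (R : realType) (H : completeNormedModType R)
    (dot : {dot H for idfun}) (hdot : norm_induced_by dot)
    (hsep : separable H)
    (T : H -> H) (alpha : R) (halpha : 0 < alpha <= 1)
    (hT : averaged alpha T) (hfix : fixpoints T !=set0)
    (x d : H) (sigma : R) (hsigma : 0 <= sigma < 1) :
  forall tau : R, 0 < tau <= tau_bar T alpha sigma x d ->
    let w := x + tau *: d in
    let rho := `|residual T w| ^+ 2
               - 2 * alpha * dot (residual T w) (w - x) in
    rho >= sigma * `|residual T w| * `|residual T x|.
Proof.
move=> tau htau; cbv zeta.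
set w := x + tau *: d; set rho := (X in _ <= X).
have a0 : 0 < alpha by case/andP: halpha.
have s1 : sigma <= 1 by case/andP: hsigma => _ /ltW.
have wx : w - x = tau *: d by rewrite /w addrC addKr.
have step : 4 * alpha * `|w - x| <= (1 - sigma) * `|residual T x|.
  by rewrite wx; exact: tau_bar_step_bound.
have lip : `|residual T x| - `|residual T w| <= 2 * alpha * `|w - x|.
  have := residual_averaged_lipschitz x w hT.
  rewrite -[`|w - x|]distrC; exact/le_trans/lerB_dist.
have cs := dot_le_norm (residual T w) (w - x) hdot.
have rho_ge : `|residual T w| * (`|residual T w| - 2 * alpha * `|w - x|) <= rho.
  have : 2 * alpha * dot (residual T w) (w - x)
      <= 2 * alpha * (`|residual T w| * `|w - x|) by rewrite ler_pM2l ?mulr_gt0.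
  rewrite /rho; lra.
apply: le_trans rho_ge; rewrite mulrAC mulrC ler_wpM2l //.
lra.
Qed.
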